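(* Let $\mathcal{G}$ be an \'etale groupoid with the Fourier coefficients approximation property and let $M$ be a nonzero diagonal bimodule of $C_r^*(\mathcal{G})$. Then the following statements are equivalent. (i) $M$ is spectral. (ii) $M$ is generated linearly by all the elements of $M$ whose open supports are bisections in $\mathcal{G}$, i.e. $M$ is the closed linear span of the set of $a\in M$ such that $\mathrm{supp}'(a)$ is a bisection. (iii) For each $f\in C_c(\mathcal{G})$ and $a\in M$, the pointwise product $f\cdot a$ belongs to $M$.
   Context: An \'etale groupoid means a second countable, locally compact, Hausdorff topological groupoid $\mathcal{G}$ whose range and source maps $r,s:\mathcal{G}\to\mathcal{G}^{(0)}$ are local homeomorphisms; $\mathcal{G}^{(0)}$ is the unit space and $\mathcal{G}_u=s^{-1}(u)$. A bisection is a subset $B\subseteq\mathcal{G}$ on which both $r$ and $s$ are injective. $C_c(\mathcal{G})$ is a $*$-algebra with $f^*(\gamma)=\overline{f(\gamma^{-1})}$ and $(fg)(\gamma)=\sum_{\gamma'\in\mathcal{G}_{s(\gamma)}}f(\gamma\gamma'^{-1})g(\gamma')$; $C_r^*(\mathcal{G})$ is its completion in the norm $\|f\|_{\mathrm{red}}=\sup_{u\in\mathcal{G}^{(0)}}\|\mathrm{Ind}_u(f)\|$, where $\mathrm{Ind}_u(f)\xi(\gamma)=\sum_{\gamma'\in\mathcal{G}_u}f(\gamma\gamma'^{-1})\xi(\gamma')$ on $\ell^2(\mathcal{G}_u)$. The inclusion $C_c(\mathcal{G})\subseteq C_0(\mathcal{G})$ extends to a norm-decreasing injective linear map $j:C_r^*(\mathcal{G})\to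 C_0(\mathcal{G})$, and each $a\in C_r^*(\mathcal{G})$ is identified with the function $j(a)$; write $a(\gamma)=j(a)(\gamma)$ and $\mathrm{supp}'(a)=\{\gamma\in\mathcal{G}:a(\gamma)\neq0\}$ (the open support). $C_0(\mathcal{G}^{(0)})$ is regarded as a $C^*$-subalgebra of $C_r^*(\mathcal{G})$. For open $P\subseteq\mathcal{G}$, $C_c(P)\subseteq C_c(\mathcal{G})$ via extension by zero. A diagonal bimodule of $C_r^*(\mathcal{G})$ is a norm closed subspace $M$ such that $ab,ba\in M$ for all $a\in M$, $b\in C_0(\mathcal{G}^{(0)})$. Its spectrum is $\sigma(M)=\{\gamma\in\mathcal{G}:a(\gamma)\ne0\text{ for some }a\in M\}$. For open $P\subseteq\mathcal{G}$, $A(P)=\{a\in C_r^*(\mathcal{G}):a(\gamma)=0\text{ for all }\gamma\notin P\}$. $M$ is spectral if $M=A(\sigma(M))$. $\mathcal{G}$ has the Fourier coefficients approximation property if $a\in\overline{C_c(\mathrm{supp}'(a))}$ (closure in the reduced norm) for all $a\in C_r^*(\mathcal{G})$. The symbol $f\cdot a$ denotes the pointwise product $(f\cdot a)(\gamma)=f(\gamma)a(\gamma)$ (as opposed to the convolution product $fa$). *)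

(* Defs.v *)
From HB Require Import structures.
From mathcomp Require Import all_boot all_order all_algebra.
From mathcomp Require Import complex.
From mathcomp Require Import all_classical all_reals all_analysis.

Set Implicit Arguments.
Unset Strict Implicit.
Unset Printing Implicit Defensive.

Import Order.TTheory GRing.Theory Num.Theory.
Import numFieldNormedType.Exports.

Local Open Scope classical_set_scope.
Local Open Scope ring_scope.

(* R[i] packed as a numClosedFieldType, so that it inherits the topology and
   the norm that MathComp-Analysis puts on every numFieldType.  The norm `|z|
   has values in R[i] itself. *)
Definition Cplx (R : realType) : numClosedFieldType := R[i]%C.

(** * Etale groupoids *)

(* [mul x y] is only meaningful when [src x = rng y]. *)
Record is_groupoid (T : Type) (src rng : T -> T) (mul : T -> T -> T)
    (inv : T -> T) : Prop := IsGroupoid {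
  src_src : forall x, src (src x) = src x;
  rng_src : forall x, rng (src x) = src x;
  src_rng : forall x, src (rng x) = rng x;
  rng_rng : forall x, rng (rng x) = rng x;
  src_mul : forall x y, src x = rng y -> src (mul x y) = src y;
  rng_mul : forall x y, src x = rng y -> rng (mul x y) = rng x;
  mul_assoc : forall x y z, src x = rng y -> src y = rng z ->
    mul x (mul y z) = mul (mul x y) z;
  mul_unitr : forall x, mul x (src x) = x;
  mul_unitl : forall x, mul (rng x) x = x;
  src_inv : forall x, src (inv x) = rng x;
  rng_inv : forall x, rng (inv x) = src x;
  mul_invr : forall x, mul x (inv x) = rng x;
  mul_invl : forall x, mul (inv x) x = src x
}.

(* [f] is a local homeomorphism from X to the subset B of Y equipped with the
   subspace topology: each point has an open neighborhood U on which f is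
   injective, continuous, and open as a map into B. *)
Definition local_homeomorphism_into (X Y : topologicalType) (B : set Y)
    (f : X -> Y) : Prop :=
  range f `<=` B /\
  forall x, exists U : set X,
    [/\ open_nbhs x U, set_inj U f, {within U, continuous f} &
        forall V : set X, open V -> V `<=` U ->
          open (f @` V : set (subspace B))].

Record etale_groupoid := EtaleGroupoid {
  arrow :> topologicalType;
  src : arrow -> arrow;
  rng : arrow -> arrow;
  mul : arrow -> arrow -> arrow;
  inv : arrow -> arrow;
  groupoid_axioms : is_groupoid src rng mul inv;
  mul_continuous : {within [set p : arrow * arrow | src p.1 = rng p.2],
                      continuous (fun p : arrow * arrow => mul p.1 p.2)};
  inv_continuous : continuous inv;
  arrow_second_countable : @second_countable arrow;
  arrow_locally_compact : locally_compact [set: arrow];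
  arrow_hausdorff : hausdorff_space arrow;
  rng_local_homeo : local_homeomorphism_into [set u | src u = u] rng;
  src_local_homeo : local_homeomorphism_into [set u | src u = u] src
}.

Definition unit_space (G : etale_groupoid) : set G := [set u | src u = u].
Arguments unit_space G : clear implicits.

Definition src_fiber (G : etale_groupoid) (u : G) : set G :=
  [set g | src g = u].

Definition bisection (G : etale_groupoid) (B : set G) : Prop :=
  set_inj B (@rng G) /\ set_inj B (@src G).

(** * Function spaces *)

Definition open_support (R : realType) (T : Type) (f : T -> Cplx R) : set T :=
  [set x | f x != 0].

(* C_c(P) for an open subset P of X; its elements are extended by zero to X. *)
Definition Cc (R : realType) (X : topologicalType) (P : set X) :
    set (X -> Cplx R) :=
  [set f | [/\ continuous f, compact (closure (open_support f)) &
               closure (open_support f) `<=` P]].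

(* C_0(P) for a subspace P of X; its elements are extended by zero to X. *)
Definition C0 (R : realType) (X : topologicalType) (P : set X) :
    set (X -> Cplx R) :=
  [set f | [/\ {within P, continuous f},
               forall e : Cplx R, 0 < e ->
                 exists2 K : set X, compact K /\ K `<=` P &
                   forall x, (P `\` K) x -> `|f x| < e &
               forall x, ~ P x -> f x = 0]].

(* The finitely supported sum \sum_(h \in _) is the right one for f, g in
   C_c(G): compact sets meet each fiber of src and rng in a finite set. *)
Definition convolution (R : realType) (G : etale_groupoid) (f g : G -> Cplx R) :
    G -> Cplx R :=
  fun x => \sum_(h \in src_fiber (src x)) f (mul x (inv h)) * g h.

Definition involution (R : realType) (G : etale_groupoid) (f : G -> Cplx R) :
    G -> Cplx R :=
  fun x => (f (inv x))^*.

(** * The reduced norm *)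

(* Elements of l^2(G_u) are represented by functions on the whole of G, of
   which only the values on G_u are ever used. *)
Definition l2norm (R : realType) (G : etale_groupoid) (u : G)
    (xi : G -> Cplx R) : \bar R :=
  ((\esum_(g in src_fiber u) ((complex.Re `|xi g|) ^+ 2)%:E) `^ 2^-1)%E.

Definition Ind (R : realType) (G : etale_groupoid) (u : G) (f : G -> Cplx R)
    (xi : G -> Cplx R) : G -> Cplx R :=
  fun x => \sum_(h \in src_fiber u) f (mul x (inv h)) * xi h.

Definition Ind_norm (R : realType) (G : etale_groupoid) (u : G)
    (f : G -> Cplx R) : \bar R :=
  ereal_sup [set l2norm u (Ind u f xi) |
             xi in [set xi : G -> Cplx R | (l2norm u xi <= 1)%E]].

Definition red_norm (R : realType) (G : etale_groupoid) (f : G -> Cplx R) :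
    \bar R :=
  ereal_sup [set Ind_norm u f | u in unit_space G].

(** * The reduced C*-algebra *)

(* A completion of C_c(G) for the reduced norm, i.e. a Banach algebra with
   isometric involution together with an isometric *-homomorphism [red_emb] of
   C_c(G) onto a dense subset (the values of [red_emb] outside C_c(G) are
   irrelevant), and the contractive linear extension [coef], a |-> j(a), of the
   inclusion of C_c(G) in C_0(G).  These data are unique up to unique
   isomorphism; the remaining axioms of a C*-algebra and the injectivity of
   [coef] are consequences. *)
Record reduced_Cstar_algebra (R : realType) (G : etale_groupoid) :=
    ReducedCstarAlgebra {
  red_alg :> completeNormedModType (Cplx R);
  red_mul : red_alg -> red_alg -> red_alg;
  red_star : red_alg -> red_alg;
  red_emb : (G -> Cplx R) -> red_alg;
  coef : red_alg -> G -> Cplx R;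
  red_mul_linearl : forall (c : Cplx R) (a b d : red_alg),
    red_mul (c *: a + b) d = c *: red_mul a d + red_mul b d;
  red_mul_linearr : forall (c : Cplx R) (a b d : red_alg),
    red_mul d (c *: a + b) = c *: red_mul d a + red_mul d b;
  red_mul_norm : forall a b : red_alg, `|red_mul a b| <= `|a| * `|b|;
  red_star_antilinear : forall (c : Cplx R) (a b : red_alg),
    red_star (c *: a + b) = c^* *: red_star a + red_star b;
  red_star_norm : forall a : red_alg, `|red_star a| = `|a|;
  red_emb_linear : forall (c : Cplx R) (f g : G -> Cplx R),
    Cc setT f -> Cc setT g ->
    red_emb (fun x => c * f x + g x) = c *: red_emb f + red_emb g;
  red_emb_mul : forall f g : G -> Cplx R, Cc setT f -> Cc setT g ->
    red_emb (convolution f g) = red_mul (red_emb f) (red_emb g);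
  red_emb_star : forall f : G -> Cplx R, Cc setT f ->
    red_emb (involution f) = red_star (red_emb f);
  red_emb_norm : forall f : G -> Cplx R, Cc setT f ->
    ((complex.Re `|red_emb f|)%:E = red_norm f)%E;
  red_emb_dense : closure (red_emb @` Cc setT) = setT;
  coef_C0 : forall a : red_alg, C0 setT (coef a);
  coef_linear : forall (c : Cplx R) (a b : red_alg) (x : G),
    coef (c *: a + b) x = c * coef a x + coef b x;
  coef_norm : forall (a : red_alg) (x : G), `|coef a x| <= `|a|;
  coef_emb : forall f : G -> Cplx R, Cc setT f -> coef (red_emb f) = f
}.

(* supp'(a) *)
Definition supp' (R : realType) (G : etale_groupoid)
    (A : reduced_Cstar_algebra R G) (a : A) : set G := open_support (coef a).

(* C_0(G^(0)) as a subalgebra of the reduced C*-algebra. *)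
Definition diagonal (R : realType) (G : etale_groupoid)
    (A : reduced_Cstar_algebra R G) : set A :=
  [set b | C0 (unit_space G) (coef b)].
Arguments diagonal {R G} A.

Definition fourier_coefficients_approximation (R : realType)
    (G : etale_groupoid) (A : reduced_Cstar_algebra R G) : Prop :=
  forall a : A, closure (@red_emb R G A @` Cc (supp' a)) a.

(** * Diagonal bimodules *)

Definition diagonal_bimodule (R : realType) (G : etale_groupoid)
    (A : reduced_Cstar_algebra R G) (M : set A) : Prop :=
  [/\ closed M, M 0,
      forall (c : Cplx R) (a b : A), M a -> M b -> M (c *: a + b) &
      forall a b : A, M a -> diagonal A b ->
        M (red_mul a b) /\ M (red_mul b a)].

Definition spectrum (R : realType) (G : etale_groupoid)
    (A : reduced_Cstar_algebra R G) (M : set A) : set G :=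
  [set x | exists2 a, M a & coef a x != 0].

(* A(P) *)
Definition supported_in (R : realType) (G : etale_groupoid)
    (A : reduced_Cstar_algebra R G) (P : set G) : set A :=
  [set a | forall x, ~ P x -> coef a x = 0].
Arguments supported_in {R G} A P.

Definition spectral (R : realType) (G : etale_groupoid)
    (A : reduced_Cstar_algebra R G) (M : set A) : Prop :=
  M = supported_in A (spectrum M).

Definition linear_span (K : numFieldType) (V : lmodType K) (S : set V) :
    set V :=
  [set v | exists (n : nat) (c : 'I_n -> K) (s : 'I_n -> V),
    (forall i, S (s i)) /\ v = \sum_(i < n) c i *: s i].

(* Main.v *)
Require Import Defs.
From mathcomp Require Import all_boot all_order all_algebra.
From mathcomp Require Import complex lra.
From mathcomp Require Import all_classical all_reals all_analysis.

Import Order.TTheory GRing.Theory Num.Theory.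
Import numFieldNormedType.Exports.

Local Open Scope classical_set_scope.
Local Open Scope ring_scope.

(** Everything rests on one principle.  Under the approximation property,
    membership of [a] in a closed subspace only has to be tested on functions
    in C_c(supp' a), and a partition of unity ([Cc_localization]) cuts such a
    function into pieces supported in arbitrarily small open sets.  The
    approximation property also makes [coef] injective ([coef_inj]), so an
    element of the algebra may be recognized from its coefficients.

    (i) => (ii).  Cut f in C_c(supp' a) into pieces supported in open
    bisections.  Each piece vanishes off the spectrum, so it lies in M when M
    is spectral.

    (ii) => (iii).  The function f may be taken with support in an open
    bisection.  There the reduced norm is dominated by the sup norm
    ([red_emb_bisection_norm]), since each operator Ind_u(f) is a weighted
    partial permutation of the fiber; hence the pointwise product with f is a
    bounded operator T_f ([pointwise_mul_lipschitz]), and it is enough to show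
    that T_f b is in M when b is in M and B = supp'(b) is a bisection.  By
    approximation once more, this follows from C_c(B) being contained in M
    ([bimodule_Cc_bisection]): for k in C_c(B) the quotient q = k / b is in
    C_c(B); because the range map is injective and open on B, q = d o r on B
    for some d in C_c(G^(0)), and then k = d b, a product with an element of the
    diagonal.

    (iii) => (i).  A function k with support in supp'(b), where b is in M, is
    the pointwise product of k / b with b, hence is in M.  The sets supp'(b)
    cover the spectrum, so localization puts C_c(sigma(M)) in M, and
    approximation puts A(sigma(M)) in M. *)

(** * Localization of compactly supported functions *)

Lemma continuous_real_complex {R : realType} :
  continuous (fun t : R => (t%:C)%C : Cplx R).
Proof.
move=> t; apply/cvgrPdist_lt => /= e e0.
have eE : e = ((complex.Re e)%:C)%C by rewrite RRe_real// gtr0_real.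
have re0 : 0 < complex.Re e by move: e0; rewrite eE ltcR.
near=> s; rewrite -rmorphB/= eE normc_def/= expr0n/= addr0 sqrtr_sqr ltcR.
near: s; exact: (@cvgr_dist_lt _ _ _ (nbhs t) _ id t cvg_id _ re0).
Unshelve. all: by end_near. Qed.

(** A Urysohn function for [x] and the complement of [V], rescaled so that it is
    constant near [x] and vanishes in a neighborhood of the complement: this is
    what keeps the closed support, and not just the open one, inside [V]. *)
Lemma bump_function {R : realType} {X : topologicalType} (x : X) (V : set X) :
  locally_compact [set: X] -> hausdorff_space X -> open V -> V x ->
  exists g : X -> Cplx R, [/\ continuous g, \forall y \near x, g y = 1 &
    closure (open_support g) `<=` V].
Proof.
move=> lcX hX oV Vx.
have /(uniform_separatorP (R := R))[f [cf _ f0 f1]] :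
    uniform_separator [set x] (~` V).
  have cV : closed (~` V) by exact: open_closedC.
  exact: (@locally_compact_completely_regular X R lcX hX x _ cV (fun k => k Vx)).
have fx : f x = 0 by apply: f0; exists x.
have fnV y : ~ V y -> f y = 1 by move=> nVy; apply: f1; exists y.
pose phi (y : X) : R := Num.max 0 (Num.min 1 (2 - 3 * f y)).
exists (fun y => ((phi y)%:C)%C); split.
- have caff : continuous (fun y => 2 - 3 * f y).
    move=> y; apply: cvgB; first exact: cvg_cst.
    by apply: cvgM; [exact: cvg_cst|exact: cf].
  have cmin := min_fun_continuous (T := R) (@cst_continuous X R 1) caff.
  have cphi := max_fun_continuous (T := R) (@cst_continuous X R 0) cmin.
  by move=> y; apply: continuous_comp; [exact: cphi|
    exact: continuous_real_complex].
- have : \forall y \near x, f y < 3^-1.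
    by apply: (cvgr_lt (f x)); [exact: cf|rewrite fx invr_gt0 ltr0n].
  apply: filterS => y fy; rewrite /phi min_l; last by lra.
  by rewrite max_r.
- move=> y; apply: contraPP => nVy cly.
  have : \forall z \near y, 2/3 < f z.
    by apply: (cvgr_gt (f y)); [exact: cf|rewrite (fnV _ nVy); lra].
  move=> /cly[z []]; rewrite /open_support/= => + fz.
  rewrite /phi max_l ?eqxx//; rewrite ge_min; apply/orP; right; lra.
Qed.

Lemma subset_closed_closure {X : topologicalType} (A K : set X) :
  closed K -> A `<=` K -> closure A `<=` K.
Proof. by move=> cK AK; rewrite [K](closure_id K).1//; exact: closureS. Qed.

Lemma closed_eq0_near {R : realType} {X : topologicalType} (K : set X) (f : X -> Cplx R) x :
  closed K -> open_support f `<=` K -> ~ K x -> \forall y \near x, f y = 0.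
Proof.
move=> cK fK nKx; have : open_nbhs x (~` K) by split=> //; exact: closed_openC.
move=> /open_nbhs_nbhs; apply: filterS => y nKy.
by apply: contra_notP nKy => /eqP; exact: fK.
Qed.

Lemma continuous_closed_support {R : realType} {X : topologicalType}
    (K : set X) (f : X -> Cplx R) :
  closed K -> open_support f `<=` K -> {in K, continuous f} -> continuous f.
Proof.
move=> cK fK cf x; have [Kx|nKx] := pselect (K x); first by apply: cf; exact/mem_set.
have f0 := closed_eq0_near _ _ _ cK fK nKx.
rewrite /continuous_at (nbhs_singleton f0).
apply: (cvg_trans (near_eq_cvg (f := fun=> 0) _)); last exact: cvg_cst.
by apply: filterS f0 => y ->.
Qed.

Lemma compact_Cc {R : realType} {X : topologicalType} (P K : set X)
    (f : X -> Cplx R) :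
  hausdorff_space X -> compact K -> K `<=` P -> continuous f ->
  open_support f `<=` K -> Cc P f.
Proof.
move=> hX cK KP cf fK; have clK := compact_closed hX cK.
have sK := subset_closed_closure _ _ clK fK.
split=> //; last exact: subset_trans KP.
exact: subclosed_compact (@closed_closure _ _) cK sK.
Qed.

Lemma Cc_mul {R : realType} {X : topologicalType} (P : set X) (f g : X -> Cplx R) :
  Cc P f -> continuous g -> Cc P (fun x => f x * g x).
Proof.
move=> [cf kf fP] cg.
have sub : closure (open_support (fun x => f x * g x)) `<=` closure (open_support f).
  apply: closureS => x; rewrite /open_support/=; apply: contra => /eqP->.
  by rewrite mul0r.
split; [|exact: subclosed_compact (@closed_closure _ _) kf sub|exact: subset_trans fP].
by move=> x; apply: cvgM; [exact: cf|exact: cg].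
Qed.

Lemma Cc_add {R : realType} {X : topologicalType} (P : set X) (f g : X -> Cplx R) :
  Cc P f -> Cc P g -> Cc P (fun x => f x + g x).
Proof.
move=> [cf kf fP] [cg kg gP].
have sub : closure (open_support (fun x => f x + g x)) `<=`
    closure (open_support f) `|` closure (open_support g).
  rewrite -closureU; apply: closureS => x; rewrite /open_support/= => fg0.
  have [fx0|fx0] := eqVneq (f x) 0; [right|by left].
  by move: fg0; rewrite fx0 add0r.
split.
- by move=> x; apply: cvgD; [exact: cf|exact: cg].
- exact: subclosed_compact (@closed_closure _ _) (compactU kf kg) sub.
- by apply: (subset_trans sub) => x [/fP|/gP].
Qed.

Lemma Cc_subset {R : realType} {X : topologicalType} (P Q : set X) (f : X -> Cplx R) :
  P `<=` Q -> Cc P f -> Cc Q f.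
Proof. by move=> PQ [cf kf fP]; split=> //; exact: subset_trans PQ. Qed.

Lemma Cc0 {R : realType} {X : topologicalType} (P : set X) :
  Cc P (fun=> 0 : Cplx R).
Proof.
have s0 : open_support (fun _ : X => 0 : Cplx R) = set0.
  by apply/seteqP; split=> x //=; rewrite /open_support/= eqxx.
split; first exact: cst_continuous.
- by rewrite s0 closure0; exact: compact0.
- by rewrite s0 closure0.
Qed.

(** A partition of unity without division.  If the bump functions g_1, ..., g_n
    are such that some g_i equals 1 at each point of the support of [f], then
    f (1 - g_1) ... (1 - g_n) = 0, and expanding f = f g_1 + f (1 - g_1), then
    f (1 - g_1), and so on, writes [f] as a sum of functions each having one of
    the g_i as a factor. *)
Lemma Cc_localization {R : realType} {X : topologicalType}
    (P : set X) (S : set (X -> Cplx R)) :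
  locally_compact [set: X] -> hausdorff_space X ->
  S (fun=> 0) -> (forall f g, S f -> S g -> S (fun x => f x + g x)) ->
  (forall x, P x -> exists V, [/\ open V, V x & Cc V `<=` S]) ->
  Cc P `<=` S.
Proof.
move=> lcX hX S0 SD locS f Ccf; have [cf kf fP] := Ccf.
have locg (x : X) : exists g : X -> Cplx R, P x ->
    [/\ continuous g, \forall y \near x, g y = 1 &
        forall h, Cc P h -> S (fun y => h y * g y)].
  have [Px|] := pselect (P x); last by exists (fun=> 0).
  have [V [oV Vx VS]] := locS x Px.
  have [g [cg g1 gV]] := bump_function (R := R) x V lcX hX oV Vx.
  exists g => _; split=> // h Cch; apply: VS.
  have [ch kh _] := Cc_mul _ _ _ Cch cg; split=> //.
  apply: subset_trans gV; apply: closureS => y; rewrite /open_support/=.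
  by apply: contra => /eqP->; rewrite mulr0.
have {locg}[g gP] := choice locg.
(* The lists of centers, ordered by inclusion: a property holding eventually
   along [F] and locally on the compact support holds on the whole support for
   a single list. *)
pose F : set_system (seq X) := filter_from [set: seq X]
  (fun s : seq X => [set t : seq X | {subset s <= t}]).
have FF : Filter F.
  apply: filter_from_filter; first by exists [::].
  move=> s t _ _; exists (s ++ t) => // u stu.
  by split=> z zs; apply: stu; rewrite mem_cat zs ?orbT.
have /compact_near_coveringP/(_ _ F
  (fun (s : seq X) y => exists2 x, x \in s & P x /\ g x y = 1) FF)[] := kf.
  move=> x /fP Px; have [_ g1 _] := gP x Px.
  exists ([set y | g x y = 1], [set t : seq X | {subset [:: x] <= t}]).
    by split=> //=; exists [:: x].
  by move=> [y t] [/= gxy xt]; exists x => //; apply: xt; rewrite mem_head.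
move=> t _ /(_ t (fun _ => id)) cov.
suff main : forall (s : seq X) (h : X -> Cplx R), {subset s <= P} -> Cc P h ->
    (forall y, h y != 0 -> exists2 x, x \in s & g x y = 1) -> S h.
  apply: (main [seq x <- t | x \in P]) => // [x|y fy].
    by rewrite mem_filter => /andP[].
  have [x xt [Px gxy]] := cov y (@subset_closure _ (open_support f) y fy).
  by exists x; rewrite ?mem_filter ?xt ?andbT //; exact/mem_set.
elim=> [|x s IHs] h sP Ph hs.
  rewrite (_ : h = fun=> 0)//; apply/funext => y; apply: contrapT => /eqP.
  by move=> /hs[].
have Px : P x by apply/set_mem/sP; rewrite mem_head.
have [cg g1 Sg] := gP x Px.
have -> : h = fun y => h y * g x y + h y * (1 - g x y).
  by apply/funext => y; rewrite mulrBr mulr1 addrC subrK.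
apply: SD; first exact: Sg.
apply: IHs.
- by move=> z zs; apply: sP; rewrite inE zs orbT.
- apply: (Cc_mul P h (fun y => 1 - g x y) Ph) => z.
  by apply: cvgB; [exact: cvg_cst|exact: cg].
- move=> y hy; have [|z] := hs y.
    by apply: contra hy => /eqP->; rewrite mul0r.
  rewrite inE => /orP[/eqP-> gxy|zs gzy]; last by exists z.
  by move: hy; rewrite gxy subrr mulr0 eqxx.
Qed.

(** * Topology of etale groupoids *)

Lemma local_homeo_continuous {X Y : topologicalType} (B : set Y) (f : X -> Y) :
  local_homeomorphism_into B f -> continuous f.
Proof.
move=> [_ lf] x; have [U [[oU Ux] _ + _]] := lf x.
by rewrite continuous_open_subspace// => /(_ x (mem_set Ux)).
Qed.

(** Near a unit [u] the range map is injective, and [x] and [rng x] are both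
    close to [u] and have the same range, so [x = rng x]. *)
Lemma unit_space_open (G : etale_groupoid) : open (unit_space G).
Proof.
have lr := rng_local_homeo G; have cr := local_homeo_continuous _ _ lr.
have ax := groupoid_axioms G.
rewrite openE => u uu; have [U [[oU Uu] injU _ _]] := lr.2 u.
have ru : rng u = u by rewrite -uu (rng_src ax).
have nU : nbhs u (U `&` @rng G @^-1` U).
  by apply: filterI; [|apply: cr; rewrite ru]; exact: open_nbhs_nbhs.
apply: filterS nU => x [Ux Urx]; rewrite /unit_space/=.
have -> : x = rng x by apply: injU; rewrite ?inE// (rng_rng ax).
exact: src_rng ax _.
Qed.

Lemma rng_open (G : etale_groupoid) (V : set G) : open V -> open (@rng G @` V).
Proof.
move=> oV; have lr := rng_local_homeo G.
rewrite openE => _ [x Vx <-]; have [U [[oU Ux] _ _ oimg]] := lr.2 x.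
have oUV : open (@rng G @` (U `&` V)).
  have oS : open (@rng G @` (U `&` V) : set (subspace (unit_space G))).
    by apply: oimg; [exact: openI|exact: subIsetl].
  have sub : @rng G @` (U `&` V) `<=` unit_space G.
    by move=> _ [y _ <-]; apply: lr.1; exists y.
  have := @open_setIS _ (unit_space G) _ (unit_space_open G).
  by move=> /(_ (@rng G @` (U `&` V))); rewrite (setIidl sub) => ->.
apply: (@filterS _ (nbhs (rng x)) _ (@rng G @` (U `&` V))).
  by apply: image_subset; exact: subIsetr.
by apply: open_nbhs_nbhs; split=> //; exists x.
Qed.

Lemma bisection_subset (G : etale_groupoid) (B B' : set G) :
  B `<=` B' -> bisection B' -> bisection B.
Proof.
move=> BB' [injr injs]; split=> x y; rewrite !inE => /BB' Bx /BB' By.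
- by apply: injr; rewrite inE.
- by apply: injs; rewrite inE.
Qed.

Lemma open_bisection_nbhs (G : etale_groupoid) (x : G) :
  exists U : set G, [/\ open U, U x & bisection U].
Proof.
have [U [[oU Ux] injU _ _]] := (rng_local_homeo G).2 x.
have [V [[oV Vx] injV _ _]] := (src_local_homeo G).2 x.
exists (U `&` V); split; [exact: openI|by []|].
by split=> y z; rewrite !inE => -[Uy Vy] [Uz Vz];
  [apply: injU|apply: injV]; rewrite inE.
Qed.

(** The function [d] is [h] composed with the inverse of the range map of [B],
    extended by zero.  It is continuous on the image of the support of [h] because
    the range map is open, and it vanishes off that image, which is compact and
    hence closed. *)
Lemma pushforward_rng {R : realType} {G : etale_groupoid} (B : set G)
    (h : G -> Cplx R) :
  open B -> set_inj B (@rng G) -> Cc B h ->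
  exists2 d : G -> Cplx R, Cc (unit_space G) d &
    forall x, B x -> d (rng x) = h x.
Proof.
move=> oB injB [ch kh hB]; have lr := rng_local_homeo G.
have hG := @arrow_hausdorff G; have cr := local_homeo_continuous _ _ lr.
have [d [dB dnB]] : exists d : G -> Cplx R, (forall x, B x -> d (rng x) = h x) /\
    (forall y, ~ (@rng G @` B) y -> d y = 0).
  have dex (y : G) : exists t : Cplx R, (forall x, B x -> rng x = y -> t = h x) /\
      (~ (@rng G @` B) y -> t = 0).
    have [[x Bx xy]|nBy] := pselect ((@rng G @` B) y).
      exists (h x); split=> [z Bz zy|]; last by case; exists x.
      by congr h; apply: injB; rewrite ?inE// xy.
    by exists 0; split=> // x Bx xy; case: nBy; exists x.
  have [d dP] := choice dex.
  exists d; split=> [x Bx|y]; last exact: (dP y).2.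
  exact: (dP (rng x)).1.
exists d; last exact: dB.
pose K := closure (open_support h).
have kK : compact (@rng G @` K).
  by apply: continuous_compact kh; exact: continuous_subspaceT.
have dK : open_support d `<=` @rng G @` K.
  move=> y; rewrite /open_support/= => dy.
  have [[x Bx xy]|/dnB dy0] := pselect ((@rng G @` B) y); last first.
    by rewrite dy0 eqxx in dy.
  by exists x => //; apply: subset_closure; rewrite /open_support/= -dB// xy.
have clK := compact_closed hG kK.
apply: (compact_Cc (unit_space G) _ d hG kK _ _ dK).
  by move=> _ [x _ <-]; apply: lr.1; exists x.
apply: (continuous_closed_support _ _ clK dK) => _ /set_mem[x Kx <-].
have Bx : B x by exact: hB.
apply/cvgrPdist_lt => e e0; rewrite dB//.
have : nbhs x ([set z | `|h x - h z| < e] `&` B).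
  apply: filterI; last by apply: open_nbhs_nbhs; split.
  by have := ch x; move/cvgrPdist_lt => /(_ e e0).
rewrite nbhsE => -[W [oW Wx] Wsub].
have : nbhs (rng x) (@rng G @` W).
  by apply: open_nbhs_nbhs; split; [exact: rng_open|exists x].
by apply: filterS => _ [z /Wsub[hz Bz] <-]; rewrite dB.
Qed.

(** * The reduced norm of a function supported in a bisection *)

Lemma mulgKV {G : etale_groupoid} (x h : G) : src x = src h ->
  Defs.mul (Defs.mul x (Defs.inv h)) h = x.
Proof.
move=> xh; have ax := groupoid_axioms G.
rewrite -(mul_assoc ax) ?(rng_inv ax) ?(src_inv ax)// (mul_invl ax) -xh.
exact: mul_unitr ax _.
Qed.

Lemma rng_mulV {G : etale_groupoid} (x h : G) : src x = src h ->
  rng (Defs.mul x (Defs.inv h)) = rng x.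
Proof.
move=> xh; have ax := groupoid_axioms G.
by rewrite (rng_mul ax)// (rng_inv ax).
Qed.

Lemma src_mulV {G : etale_groupoid} (x h : G) : src x = src h ->
  src (Defs.mul x (Defs.inv h)) = rng h.
Proof.
move=> xh; have ax := groupoid_axioms G.
by rewrite (src_mul ax) ?(rng_inv ax)// (src_inv ax).
Qed.

Lemma mulV_injl {G : etale_groupoid} (x h h' : G) :
  src x = src h -> src x = src h' -> Defs.mul x (Defs.inv h) = Defs.mul x (Defs.inv h') -> h = h'.
Proof.
move=> xh xh' e; have ax := groupoid_axioms G.
have invK (k : G) : Defs.inv (Defs.inv k) = k.
  have -> : Defs.inv (Defs.inv k) = Defs.mul (Defs.mul (Defs.inv (Defs.inv k)) (Defs.inv k)) k.
    by rewrite mulgKV// !(src_inv ax, rng_inv ax).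
  by rewrite (mul_invl ax) (src_inv ax) (mul_unitl ax).
have cancel (k : G) : src x = src k -> Defs.inv k = Defs.mul (Defs.inv x) (Defs.mul x (Defs.inv k)).
  move=> xk; rewrite (mul_assoc ax) ?(src_inv ax) ?(rng_inv ax)//.
  by rewrite (mul_invl ax) xk -(rng_inv ax) (mul_unitl ax).
by rewrite -[h]invK -[h']invK (cancel h)// (cancel h')// e.
Qed.

Lemma fsbig_singleton {V : nmodType} {T : choiceType} (D : set T) (F : T -> V) (t : T) :
  D t -> (forall s, D s -> s != t -> F s = 0) -> \sum_(s \in D) F s = F t.
Proof.
move=> Dt F0; rewrite -(fsbig_widen [set t] D).
- by rewrite fsbig_set1.
- by move=> _ ->.
- by move=> s [Ds st]; apply: F0 => //; apply/eqP.
Qed.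

Lemma esum_partial_injection {R : realType} {T : choiceType} (D E : set T)
    (phi : T -> T) (a b : T -> \bar R) :
  (forall x, 0 <= b x)%E ->
  (forall x, D x -> a x != 0%E -> E (phi x) /\ (a x <= b (phi x))%E) ->
  {in [set x | D x /\ a x != 0%E] &, injective phi} ->
  (\esum_(x in D) a x <= \esum_(y in E) b y)%E.
Proof.
move=> b0 ab inj; pose D' := [set x | D x /\ a x != 0%E].
have -> : \esum_(x in D) a x = \esum_(x in D') a x.
  rewrite (_ : D' = D `&` [set x | a x != 0%E])// esum_mkcondr.
  apply: eq_esum => x Dx; case: ifPn => //.
  by rewrite notin_setE/= => /negP; rewrite negbK => /eqP.
apply: (@le_trans _ _ (\esum_(x in D') b (phi x))).
  by apply: le_esum => x [Dx ax]; case: (ab x Dx ax).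
rewrite -esum_image//.
rewrite [leRHS](esum_mkcond E) [leLHS]esum_mkcond; apply: le_esum => y _.
case: ifPn; last by case: ifP.
rewrite inE => -[x [Dx ax] <-]; rewrite ifT// inE.
by case: (ab x Dx ax).
Qed.

Section BisectionNorm.
Context {R : realType} {G : etale_groupoid}.

Lemma sqr_Re_norm_mul (c z w : Cplx R) : 0 <= c -> `|w| <= c * `|z| ->
  complex.Re `|w| ^+ 2 <= complex.Re c ^+ 2 * complex.Re `|z| ^+ 2.
Proof.
move=> c0; have reE (t : Cplx R) : 0 <= t -> t = ((complex.Re t)%:C)%C.
  by move=> t0; rewrite RRe_real// ger0_real.
have wE := reE _ (normr_ge0 w); have zE := reE _ (normr_ge0 z).
have cE := reE _ c0; rewrite wE zE {1}cE -rmorphM/= lecR => wcz.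
rewrite -exprMn lerXn2r// nnegrE.
- by rewrite -ler0c -wE.
- by rewrite mulr_ge0// -ler0c -?cE -?zE.
Qed.

(** Each row and each column of the matrix f(x h^-1), with x and h in the fiber
    of [u], has at most one nonzero entry: entries in the row x come from arrows of
    range r(x), entries in the column h from arrows of source r(h).  So [Ind u f]
    moves the coordinates of [xi] injectively and multiplies them by numbers of
    modulus at most [c]. *)
Lemma l2norm_Ind_bisection (u : G) (f xi : G -> Cplx R) (c : Cplx R) :
  bisection (open_support f) -> 0 <= c -> (forall x, `|f x| <= c) ->
  (l2norm u (Ind u f xi) <= (complex.Re c)%:E * l2norm u xi)%E.
Proof.
move=> [injr injs] c0 fc.
have rec0 : 0 <= complex.Re c by rewrite -ler0c RRe_real// ger0_real.
have unique (x h h' : G) : src x = src h -> src x = src h' ->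
    f (Defs.mul x (Defs.inv h)) != 0 -> f (Defs.mul x (Defs.inv h')) != 0 -> h = h'.
  move=> xh xh' fh fh'; apply: (mulV_injl x) => //.
  by apply: injr; rewrite ?inE// !rng_mulV.
have IndE (x h : G) : src x = u -> src h = u -> f (Defs.mul x (Defs.inv h)) != 0 ->
    Ind u f xi x = f (Defs.mul x (Defs.inv h)) * xi h.
  move=> xu hu fh; rewrite /Ind; apply: fsbig_singleton => // h' hu' /eqP hh'.
  have [->|fh'] := eqVneq (f (Defs.mul x (Defs.inv h'))) 0; first by rewrite mul0r.
  by case: hh'; apply: (unique x); rewrite // xu.
have partner (x : G) : exists h : G, src x = u -> Ind u f xi x != 0 ->
    src h = u /\ f (Defs.mul x (Defs.inv h)) != 0.
  have [[h [hu fh]]|nh] :=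
      pselect (exists h : G, src h = u /\ f (Defs.mul x (Defs.inv h)) != 0).
    by exists h.
  exists x => xu; rewrite /Ind fsbig1 ?eqxx// => h hu.
  have [->|fh] := eqVneq (f (Defs.mul x (Defs.inv h))) 0; first by rewrite mul0r.
  by case: nh; exists h.
(* [phi x] is the column of the nonzero entry in the row [x]. *)
have {partner}[phi phiP] := choice partner.
have esum_le : (\esum_(x in src_fiber u) ((complex.Re `|Ind u f xi x|) ^+ 2)%:E <=
    \esum_(x in src_fiber u) ((complex.Re c) ^+ 2 * (complex.Re `|xi x|) ^+ 2)%:E)%E.
  have IndN0 (x : G) : ((complex.Re `|Ind u f xi x|) ^+ 2)%:E != 0%E -> Ind u f xi x != 0.
    by apply: contra => /eqP->; rewrite normr0 expr0n.
  apply: (esum_partial_injection _ _ phi).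
  - by move=> x; rewrite lee_fin mulr_ge0 ?sqr_ge0.
  - move=> x xu /IndN0 Ix; have [pu fp] := phiP x xu Ix; split=> //.
    rewrite lee_fin; apply: sqr_Re_norm_mul => //.
    by rewrite (IndE x (phi x))// normrM ler_wpM2r.
  - move=> x y; rewrite !inE => -[xu /IndN0 Ix] [yu /IndN0 Iy] xy.
    have [pxu fx] := phiP x xu Ix; have [pyu fy] := phiP y yu Iy.
    have sx : src x = src (phi x) by rewrite xu pxu.
    have sy : src y = src (phi x) by rewrite yu pxu.
    rewrite -(mulgKV x (phi x))// -(mulgKV y (phi x))//; congr Defs.mul.
    by apply: injs; rewrite ?inE// -?xy// ?src_mulV// /open_support/= ?xy.
rewrite /l2norm; apply: (@le_trans _ _ ((((complex.Re c) ^+ 2)%:E *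
    \esum_(x in src_fiber u) ((complex.Re `|xi x|) ^+ 2)%:E) `^ 2^-1)%E).
  apply: gt0_ler_poweR => //.
  - by rewrite in_itv/= leey andbT; apply: esum_ge0 => x _; rewrite lee_fin sqr_ge0.
  - rewrite in_itv/= leey andbT mule_ge0// ?lee_fin ?sqr_ge0//.
    by apply: esum_ge0 => x _; rewrite lee_fin sqr_ge0.
  - apply: (le_trans esum_le); apply: ge_ereal_sup => _ [X [finX Xu] <-].
    under eq_fsbigr do rewrite EFinM.
    rewrite -ge0_mule_fsumr; last by move=> x; rewrite lee_fin sqr_ge0.
    apply: lee_wpmul2l; first by rewrite lee_fin sqr_ge0.
    by apply: ereal_sup_ubound; exists X.
rewrite poweRM ?lee_fin ?sqr_ge0//; last by apply: esum_ge0 => x _; rewrite lee_fin sqr_ge0.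
by rewrite poweR_EFin powR12_sqrt ?sqr_ge0// sqrtr_sqr ger0_norm.
Qed.

Lemma red_norm_bisection (f : G -> Cplx R) (c : Cplx R) :
  bisection (open_support f) -> 0 <= c -> (forall x, `|f x| <= c) ->
  (red_norm f <= (complex.Re c)%:E)%E.
Proof.
move=> bf c0 fc; rewrite /red_norm; apply: ge_ereal_sup => _ [u _ <-].
apply: ge_ereal_sup => _ [xi xi1 <-].
apply: (le_trans (l2norm_Ind_bisection u f xi c bf c0 fc)).
rewrite -[leRHS]mule1; apply: lee_wpmul2l => //.
by rewrite lee_fin -ler0c RRe_real// ger0_real.
Qed.

Lemma red_emb_bisection_norm (A : reduced_Cstar_algebra R G) (f : G -> Cplx R)
    (c : Cplx R) :
  Cc setT f -> bisection (open_support f) -> 0 <= c -> (forall x, `|f x| <= c) ->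
  `|red_emb A f| <= c.
Proof.
move=> Cf bf c0 fc; have := red_norm_bisection f c bf c0 fc.
rewrite -(red_emb_norm A Cf) lee_fin -lecR.
by rewrite !RRe_real// ?ger0_real.
Qed.

End BisectionNorm.

(** * Continuity, spans and quotients *)

Lemma lipschitz_closure {K : numFieldType} {V W : normedModType K} (phi : V -> W)
    (C : K) (S : set V) (N : set W) :
  0 <= C -> (forall v w, `|phi v - phi w| <= C * `|v - w|) -> closed N ->
  (forall v, S v -> N (phi v)) -> forall v, closure S v -> N (phi v).
Proof.
move=> C0 lip cN SN v clv; apply: cN => B nB.
suff /clv[s [Ss Bs]] : nbhs v (phi @^-1` B) by exists (phi s); split=> //; exact: SN.
have C1 : 0 < C + 1 by rewrite ltr_wpDl.
suff : phi @ v --> phi v by exact.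
apply/cvgrPdist_lt => e e0; near=> w.
apply: (le_lt_trans (lip v w)); apply: (@le_lt_trans _ _ ((C + 1) * `|v - w|)).
  by rewrite ler_wpM2r// lerDl.
rewrite -ltr_pdivlMl// mulrC; near: w.
by apply: (@cvgr_dist_lt _ _ _ (nbhs v) _ id v cvg_id); rewrite divr_gt0.
Unshelve. all: by end_near. Qed.

Lemma linear_span_min {K : numFieldType} {V : lmodType K} (S N : set V) :
  N 0 -> (forall c a b, N a -> N b -> N (c *: a + b)) -> S `<=` N ->
  linear_span S `<=` N.
Proof.
move=> N0 NP SN _ [n [c [s [Ss ->]]]]; apply: (big_ind N) => // [a b Na Nb|i _].
  by rewrite -[a]scale1r; exact: NP.
by rewrite -[_ *: _]addr0; apply: NP => //; exact: SN.
Qed.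

Lemma sub_linear_span {K : numFieldType} {V : lmodType K} (S : set V) :
  S `<=` linear_span S.
Proof.
move=> a Sa; exists 1%N, (fun=> 1), (fun=> a); split=> //.
by rewrite big_ord1 scale1r.
Qed.

Lemma linear_span0 {K : numFieldType} {V : lmodType K} (S : set V) :
  linear_span S 0.
Proof.
by exists 0%N, (fun=> 0), (fun=> 0); split=> [[]//|]; rewrite big_ord0.
Qed.

Lemma linear_spanD {K : numFieldType} {V : lmodType K} (S : set V) (a b : V) :
  linear_span S a -> linear_span S b -> linear_span S (a + b).
Proof.
move=> [m [c [s [Ss ->]]]] [n [d [t [St ->]]]].
exists (m + n)%N, (fun i => match fintype.split i with inl j => c j | inr j => d j end),
  (fun i => match fintype.split i with inl j => s j | inr j => t j end).
split=> [i|]; first by case: (fintype.split i).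
rewrite big_split_ord/=; congr (_ + _); apply: eq_bigr => i _.
- by rewrite (unsplitK (inl i)).
- by rewrite (unsplitK (inr i)).
Qed.

(** Dividing by [b] is harmless: the support of [k] is a compact set on which [b]
    does not vanish, and off the open support of [b] both sides of the last
    equality are zero. *)
Lemma Cc_div {R : realType} {X : topologicalType} (k b : X -> Cplx R) :
  continuous b -> Cc (open_support b) k ->
  Cc (open_support b) (fun x => k x / b x) /\
  (fun x => k x / b x * b x) = k.
Proof.
move=> cb [ck kk kb]; split; last first.
  apply/funext => x; have [kx0|kx] := eqVneq (k x) 0; first by rewrite kx0 !mul0r.
  by rewrite divfK//; apply: kb; apply: (@subset_closure _ (open_support k)).
have sub : closure (open_support (fun x => k x / b x)) `<=` closure (open_support k).
  apply: closureS => x; rewrite /open_support/=; apply: contra => /eqP->.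
  by rewrite mul0r.
split; [|exact: subclosed_compact (@closed_closure _ _) kk sub|exact: subset_trans kb].
apply: (continuous_closed_support (closure (open_support k))).
- exact: closed_closure.
- by move=> x xs; apply: sub; exact: subset_closure.
- move=> x /set_mem xk; apply: cvgM; first exact: ck.
  by apply: cvgV; [exact: kb|exact: cb].
Qed.

Lemma closed_singleton {K : numFieldType} {V : normedModType K} (v : V) :
  closed [set v].
Proof.
apply: accessible_closed_set1; apply: hausdorff_accessible.
exact: norm_hausdorff.
Qed.

(** * The reduced algebra and its diagonal bimodules *)

Section ReducedAlgebra.
Context {R : realType} {G : etale_groupoid} (A : reduced_Cstar_algebra R G).
Implicit Types (a b : A) (f g k : G -> Cplx R).

Lemma coefB a b x : coef (a - b) x = coef a x - coef b x.
Proof. by have := coef_linear (-1) b a x; rewrite scaleN1r mulN1r ![- _ + _]addrC. Qed.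

Lemma coef0 x : coef (0 : A) x = 0.
Proof. by rewrite -[0](subrr (0 : A)) coefB subrr. Qed.

Lemma coef_continuous a : continuous (coef a).
Proof.
have [+ _ _] := coef_C0 a; rewrite continuous_open_subspace; last exact: openT.
by move=> ca x; apply: ca; rewrite inE.
Qed.

Lemma supp'_open a : open (supp' a).
Proof.
have /continuousP ca := coef_continuous a.
have -> : supp' a = coef a @^-1` ~` [set 0].
  by apply/seteqP; split=> x /= /eqP.
by apply: ca; apply: closed_openC; exact: (@closed_singleton _ (Cplx R)^o).
Qed.

Lemma red_emb0 : red_emb A (fun=> 0) = 0.
Proof.
have C0 := @Cc0 R G setT.
have := red_emb_linear A 1 C0 C0; rewrite scale1r.
rewrite (_ : (fun x => _) = (fun=> 0)); last by apply/funext => x; rewrite mulr0 addr0.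
by move/(congr1 (fun v => v - red_emb A (fun=> 0))); rewrite subrr addrK.
Qed.

Lemma red_embD f g : Cc setT f -> Cc setT g ->
  red_emb A (fun x => f x + g x) = red_emb A f + red_emb A g.
Proof.
move=> Cf Cg; rewrite -[red_emb A f]scale1r -red_emb_linear//.
by congr red_emb; apply/funext => x; rewrite mul1r.
Qed.

(** An element without coefficients is approximated by functions with empty
    support. *)
Lemma coef_inj : fourier_coefficients_approximation A ->
  forall a b, coef a = coef b -> a = b.
Proof.
move=> fca a b ab; apply/eqP; rewrite -subr_eq0; apply/eqP.
have c0 : supp' (a - b) = set0.
  by apply/seteqP; split=> x //=; rewrite /supp' /open_support/= coefB ab subrr eqxx.
have := fca (a - b); rewrite c0.
apply: (@lipschitz_closure _ _ _ idfun 1 _ [set 0]) => //.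
- by move=> v w; rewrite mul1r.
- exact: closed_singleton.
- move=> _ [f [_ _ f0] <-]; rewrite -red_emb0; congr red_emb.
  apply/funext => x; apply: contrapT => /eqP fx.
  exact: (f0 x (@subset_closure _ (open_support f) x fx)).
Qed.

(** In the convolution sum at [x] only the term of index [x] survives, as
    x h^-1 is a unit only if h = x. *)
Lemma convolution_diagonal (d f : G -> Cplx R) :
  (forall x, ~ unit_space G x -> d x = 0) ->
  convolution d f = fun x => f x * d (rng x).
Proof.
move=> d0; have ax := groupoid_axioms G; apply/funext => x.
rewrite /convolution (fsbig_singleton _ _ x)//; first by rewrite (mul_invr ax) mulrC.
move=> h hx /eqP; apply: contra_notP => /eqP dn0.
have xh : src x = src h by [].
have : unit_space G (Defs.mul x (Defs.inv h)).
  by apply: contrapT => /d0 e; rewrite e mul0r eqxx in dn0.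
rewrite /unit_space/= (src_mulV x h xh) => e.
by rewrite -[RHS](mulgKV x h xh) -e (mul_unitl ax).
Qed.

(** Both sides are continuous in [b], and [convolution_diagonal] proves the
    equality on the dense subalgebra of compactly supported functions. *)
Lemma coef_diagonal_mul (d : G -> Cplx R) b x : Cc (unit_space G) d ->
  coef (red_mul (red_emb A d) b) x = coef b x * d (rng x).
Proof.
move=> Cd; have Cd' := Cc_subset _ _ _ (@subsetT _ _) Cd.
have [cd _ du] := Cd; have d0 y : ~ unit_space G y -> d y = 0.
  move=> nuy; apply: contra_notP nuy => /eqP dy; apply: du.
  exact: (@subset_closure _ (open_support d)).
pose phi (a : A) : (Cplx R)^o := coef (red_mul (red_emb A d) a) x - coef a x * d (rng x).
suff : phi b = 0 by move/eqP; rewrite subr_eq0 => /eqP.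
have clb : closure (red_emb A @` Cc setT) b by rewrite red_emb_dense.
apply: (@lipschitz_closure _ _ _ phi (`|red_emb A d| + `|d (rng x)|) _ [set 0]
  _ _ _ _ b clb).
- by rewrite addr_ge0.
- move=> v w.
  have -> : phi v - phi w =
      coef (red_mul (red_emb A d) (v - w)) x - coef (v - w) x * d (rng x).
    have -> : red_mul (red_emb A d) (v - w) =
        red_mul (red_emb A d) v - red_mul (red_emb A d) w.
      have := red_mul_linearr (-1) w v (red_emb A d).
      by rewrite !scaleN1r ![- _ + _]addrC.
    rewrite !coefB /phi mulrBl !opprB addrACA [RHS]addrACA.
    by congr (_ + _); exact: addrC.
  apply: (le_trans (ler_normB _ _)); rewrite mulrDl; apply: lerD.
    by apply: (le_trans (coef_norm _ _)); exact: red_mul_norm.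
  by rewrite normrM mulrC ler_wpM2l// coef_norm.
- exact: closed_singleton.
- move=> _ [f Cf <-]; rewrite /phi/= -(red_emb_mul A Cd' Cf) (convolution_diagonal _ _ d0).
  have cr := local_homeo_continuous _ _ (rng_local_homeo G).
  have cdr : continuous (d \o @rng G).
    by move=> y; apply: continuous_comp; [exact: cr|exact: cd].
  by rewrite (coef_emb A Cf) (coef_emb A (Cc_mul _ _ _ Cf cdr)) subrr.
Qed.

Lemma Cc_diagonal (d : G -> Cplx R) :
  Cc (unit_space G) d -> Defs.diagonal A (red_emb A d).
Proof.
move=> Cd; have Cd' := Cc_subset _ _ _ (@subsetT _ _) Cd.
have [cd kd du] := Cd.
have d0 y : ~ closure (open_support d) y -> d y = 0.
  move=> ndy; apply: contra_notP ndy => /eqP dy.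
  exact: (@subset_closure _ (open_support d)).
rewrite /Defs.diagonal/= coef_emb//; split.
- exact: continuous_subspaceT.
- move=> e e0; exists (closure (open_support d)) => // y [_ ndy].
  by rewrite d0// normr0.
- by move=> y nuy; apply: d0; apply: contra_not nuy; exact: du.
Qed.

(** Here the diagonal acts: the quotient of [k] by [b] lives on a bisection, so it
    only depends on the range, and multiplying [b] by it is multiplying [b] by an
    element of the diagonal. *)
Lemma bimodule_Cc_bisection (M : set A) b k :
  fourier_coefficients_approximation A -> diagonal_bimodule M ->
  M b -> bisection (supp' b) -> Cc (supp' b) k -> M (red_emb A k).
Proof.
move=> fca [_ _ _ MD] Mb [injr _] Ck.
have [Cq qb] := Cc_div _ _ (coef_continuous b) Ck.
have [d Cd dq] := pushforward_rng _ _ (supp'_open b) injr Cq.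
have [_] := MD b (red_emb A d) Mb (Cc_diagonal d Cd).
congr M; apply: coef_inj => //; rewrite coef_emb; last exact: Cc_subset (@subsetT _ _) Ck.
apply/funext => x; rewrite coef_diagonal_mul// -[in RHS]qb.
have [bx0|bx] := eqVneq (coef b x) 0; first by rewrite bx0 mul0r mulr0.
by rewrite dq// mulrC.
Qed.

Definition pointwise_mul f a : A := red_emb A (fun x => f x * coef a x).

Lemma Cc_coef_mul f a P : Cc P f -> Cc P (fun x => f x * coef a x).
Proof. by move=> Cf; apply: Cc_mul => //; exact: coef_continuous. Qed.

Lemma coef_pointwise_mul f a : Cc setT f ->
  coef (pointwise_mul f a) = fun x => f x * coef a x.
Proof. by move=> Cf; rewrite coef_emb//; exact: Cc_coef_mul. Qed.

Lemma pointwise_mul_linear f (c : Cplx R) a b : Cc setT f ->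
  pointwise_mul f (c *: a + b) = c *: pointwise_mul f a + pointwise_mul f b.
Proof.
move=> Cf; rewrite -red_emb_linear; try exact: Cc_coef_mul.
by congr red_emb; apply/funext => x; rewrite coef_linear mulrDr mulrCA.
Qed.

(** The coefficients of [a - b] are bounded by its norm, and likewise for [f]; on a
    bisection this sup norm estimate controls the reduced norm. *)
Lemma pointwise_mul_lipschitz f : Cc setT f -> bisection (open_support f) ->
  forall a b, `|pointwise_mul f a - pointwise_mul f b| <= `|red_emb A f| * `|a - b|.
Proof.
move=> Cf bf a b.
have -> : pointwise_mul f a - pointwise_mul f b = pointwise_mul f (a - b).
  by have := pointwise_mul_linear f (-1) b a Cf; rewrite !scaleN1r ![- _ + _]addrC.
apply: red_emb_bisection_norm; first exact: Cc_coef_mul.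
- apply: bisection_subset bf => x; rewrite /open_support/=.
  by apply: contra => /eqP->; rewrite mul0r.
- by rewrite mulr_ge0.
- move=> x; rewrite normrM ler_pM ?coef_norm//.
  by rewrite -[X in `|X x| <= _](coef_emb A Cf) coef_norm.
Qed.

(** * The three implications *)

Lemma bimodule_linear_span (M S : set A) :
  diagonal_bimodule M -> S `<=` M -> closure (linear_span S) `<=` M.
Proof.
move=> [cM M0 MP _] SM; apply: subset_closed_closure => //.
exact: linear_span_min.
Qed.

Lemma spectral_bisection_span (M : set A) :
  fourier_coefficients_approximation A -> diagonal_bimodule M -> spectral M ->
  M = closure (linear_span [set a : A | M a /\ bisection (supp' a)]).
Proof.
move=> fca hM sM; apply/seteqP; split; last by apply: bimodule_linear_span => // a [].
set S := [set a | _] => a Ma.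
apply: (@closureS _ (red_emb A @` Cc (supp' a))); last exact: fca.
suff H : Cc (supp' a) `<=` [set k | Cc setT k /\ linear_span S (red_emb A k)].
  by move=> _ [k /H[_ ?] <-].
apply: Cc_localization.
- exact: arrow_locally_compact.
- exact: arrow_hausdorff.
- by split; [exact: Cc0|rewrite red_emb0; exact: linear_span0].
- move=> f g [Cf Sf] [Cg Sg]; split; first exact: Cc_add.
  by rewrite red_embD//; exact: linear_spanD.
- move=> x ax; have [U [oU Ux bU]] := open_bisection_nbhs G x.
  exists (U `&` supp' a); split=> //; first by apply: openI => //; exact: supp'_open.
  move=> k Ck; have Ck' := Cc_subset _ _ _ (@subsetT _ _) Ck; split=> //.
  have kU y : k y != 0 -> U y /\ supp' a y.
    case: Ck => _ _ kU ky; apply: kU; exact: (@subset_closure _ (open_support k)).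
  apply: sub_linear_span; split; last first.
    rewrite /supp' coef_emb//; apply: bisection_subset bU => y.
    by rewrite /open_support/= => /kU[].
  rewrite sM /supported_in/= coef_emb// => y.
  by apply: contra_notP => /eqP/kU[_ ay]; exists a.
Qed.

Lemma bisection_span_pointwise (M : set A) :
  fourier_coefficients_approximation A -> diagonal_bimodule M ->
  M = closure (linear_span [set a : A | M a /\ bisection (supp' a)]) ->
  forall f a, Cc setT f -> M a -> M (pointwise_mul f a).
Proof.
move=> fca hM MS; have [cM M0 MP _] := hM.
suff H : Cc setT `<=` [set f | Cc setT f /\ forall a, M a -> M (pointwise_mul f a)].
  by move=> f a /H[_]; exact.
apply: Cc_localization.
- exact: arrow_locally_compact.
- exact: arrow_hausdorff.
- split=> [|a _]; first exact: Cc0.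
  rewrite /pointwise_mul (_ : (fun x => _) = (fun=> 0)) ?red_emb0//.
  by apply/funext => x; rewrite mul0r.
- move=> f g [Cf Mf] [Cg Mg]; split=> [|a Ma]; first exact: Cc_add.
  have -> : pointwise_mul (fun x => f x + g x) a = pointwise_mul f a + pointwise_mul g a.
    rewrite -red_embD; try exact: Cc_coef_mul.
    by congr red_emb; apply/funext => x; rewrite mulrDl.
  by rewrite -[pointwise_mul f a]scale1r; apply: MP; [exact: Mf|exact: Mg].
- move=> x _; have [U [oU Ux bU]] := open_bisection_nbhs G x.
  exists U; split=> // f Cf; have Cf' := Cc_subset _ _ _ (@subsetT _ _) Cf; split=> //.
  have bf : bisection (open_support f).
    apply: bisection_subset bU => y fy; case: Cf => _ _; apply.
    exact: subset_closure.
  have lip := pointwise_mul_lipschitz f Cf' bf.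
  move=> a; rewrite {1}MS; apply: (lipschitz_closure _ _ _ _ _ lip) => //.
  apply: linear_span_min.
  + rewrite /pointwise_mul (_ : (fun y => _) = (fun=> 0)) ?red_emb0//.
    by apply/funext => y; rewrite coef0 mulr0.
  + by move=> c v w; rewrite pointwise_mul_linear//; exact: MP.
  + move=> b [Mb bb].
    (* The approximation property trades [b] for functions supported in its open
       support, where the product with [f] is again such a function. *)
    apply: (lipschitz_closure _ _ _ M _ lip _ _ _ (fca b)) => //.
    move=> _ [g Cg <-]; have Cg' := Cc_subset _ _ _ (@subsetT _ _) Cg.
    apply: (bimodule_Cc_bisection _ b) => //; rewrite coef_emb//.
    have [cf _ _] := Cf.
    rewrite (_ : (fun y => f y * g y) = fun y => g y * f y); first exact: Cc_mul.
    by apply/funext => y; rewrite mulrC.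
Qed.

Lemma pointwise_spectral (M : set A) :
  fourier_coefficients_approximation A -> diagonal_bimodule M ->
  (forall f a, Cc setT f -> M a ->
    exists2 b, M b & forall x, coef b x = f x * coef a x) ->
  spectral M.
Proof.
move=> fca hM hpt; have [cM M0 MP _] := hM.
have H : Cc (spectrum M) `<=` [set k | Cc setT k /\ M (red_emb A k)].
  apply: Cc_localization.
  - exact: arrow_locally_compact.
  - exact: arrow_hausdorff.
  - by split; [exact: Cc0|rewrite red_emb0].
  - move=> f g [Cf Mf] [Cg Mg]; split; first exact: Cc_add.
    by rewrite red_embD// -[red_emb A f]scale1r; exact: MP.
  - move=> x [b Mb bx]; exists (supp' b); split=> //; first exact: supp'_open.
    move=> k Ck; have Ck' := Cc_subset _ _ _ (@subsetT _ _) Ck; split=> //.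
    have [Cq qb] := Cc_div _ _ (coef_continuous b) Ck.
    have [b' Mb' b'q] := hpt _ b (Cc_subset _ _ _ (@subsetT _ _) Cq) Mb.
    suff -> : red_emb A k = b' by [].
    by apply: coef_inj => //; rewrite coef_emb// -[LHS]qb; apply/funext => y; rewrite b'q.
apply/seteqP; split=> a.
  by move=> Ma x; apply: contra_notP => /eqP ax; exists a.
move=> suppa; apply: cM.
apply: (@closureS _ (red_emb A @` Cc (supp' a))); last exact: fca.
move=> _ [k Ck <-]; have [] // := H k; apply: Cc_subset Ck => x ax.
by apply: contrapT => /suppa ax0; rewrite /supp' /open_support/= ax0 eqxx in ax.
Qed.

End ReducedAlgebra.

Theorem theorem3p18 (R : realType) (G : etale_groupoid)
    (A : reduced_Cstar_algebra R G)
    (hFCAP : fourier_coefficients_approximation A)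
    (M : set A) (hM : diagonal_bimodule M)
    (hM0 : exists2 a : A, M a & a != 0) :
  [<-> spectral M;
       M = closure (linear_span [set a : A | M a /\ bisection (supp' a)]);
       forall (f : G -> Cplx R) (a : A), Cc setT f -> M a ->
         exists2 b : A, M b & forall x : G, coef b x = f x * coef a x].
Proof.
tfae.
- exact: spectral_bisection_span.
- move=> MS f a Cf Ma; exists (pointwise_mul A f a).
    exact: bisection_span_pointwise.
  by move=> x; rewrite coef_pointwise_mul.
- exact: pointwise_spectral.
Qed.
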